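(* Let $n=4k+3$ with $k\ge1$ an integer, let $\sigma\in(0,1)$ and $\tau>0$ be constants. Consider solutions $(y_1,\dots,y_4)$, with $K=e^{y_1}$, $t_i=e^{y_{i+1}}$ ($1\le i\le3$), of the boundary value problem (BVP) described in the context, whose initial data satisfy $\sigma<t_1(0),t_2(0),t_3(0)<\frac{n+5}{3}$, are labelled so that $t_1(0)\ge t_2(0)\ge t_3(0)$, and satisfy $$t_i(0)^{-1}(t_j(0)+t_k(0))>1\quad\text{for any }\{i,j,k\}=\{1,2,3\}$$ and $$2C_{13}C_{23}+2C_{13}+2C_{23}-C_{13}^2-C_{23}^2-1>\tau$$ for all constants $C_{13},C_{23}$ with $1\le C_{13}\le\frac{t_1(0)}{t_3(0)}$ and $1\le C_{23}\le\frac{t_2(0)}{t_3(0)}$. Then there exists a uniform constant $C=C(\sigma,\tau)>0$, independent of the solution and of the initial data $t_i(0)$, such that $$|y_i^{(k)}(x)|\le C\,x^{2-k}$$ for $k=1,2$, $1\le i\le4$ and $x\in[0,\frac34]$, where $y_i^{(k)}$ denotes the $k$-th order derivative of $y_i$ with respect to $x$. The same estimate holds on the interval $[0,1-\epsilon]$ for any small $\epsilon>0$, with some constant $C=C(\sigma,\tau,\epsilon)>0$.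
   Context: (BVP): $y_1,\dots,y_4\in C^\infty([0,1])$ satisfy on $(0,1)$, with $K=e^{y_1}$, $t_i=e^{y_{i+1}}$, $P=(K^{-1}t_1t_2t_3)^{1/n}$ and $$\Psi=((n-1)y_2'-y_3'-y_4')^2+(-y_2'+(n-1)y_3'-y_4')^2+(-y_2'-y_3'+(n-1)y_4')^2+(n-3)(y_2'+y_3'+y_4')^2,$$ the equations $$y_1''-\tfrac{1+3x^2}{x(1-x^2)}y_1'+\tfrac{1}{2n^2}\big[n(y_1')^2+\Psi\big]=0,$$ $$y_1''-\tfrac{2n-1+(2n+1)x^2}{x(1-x^2)}y_1'+\tfrac12(y_1')^2+\tfrac{8}{(1-x^2)^2}\Big[n(n-1)-P\Big((n-3)(n+5)-(n-3)(t_1+t_2+t_3)+\tfrac{2(2t_1t_2+2t_1t_3+2t_2t_3-t_1^2-t_2^2-t_3^2)}{t_1t_2t_3}\Big)\Big]=0,$$ and, for each $\{a,b,c\}=\{1,2,3\}$ (so three equations, for $y_{a+1}=\log t_a$), $$y_{a+1}''-\tfrac{n-1+(n+1)x^2}{x(1-x^2)}y_{a+1}'+\tfrac12y_1'y_{a+1}'-\tfrac{8P}{(1-x^2)^2}\Big[(n-1)t_a+2t_b+2t_c-n-5+\tfrac{2(t_a^2-(t_b-t_c)^2)}{t_1t_2t_3}\Big]=0,$$ together with the boundary conditions: $t_i(0)$ ($1\le i\le3$) prescribed positive numbers, $K(1)=t_i(1)=1$ for $1\le i\le3$, and $y_j'(0)=y_j'(1)=0$ for $1\le j\le4$. (This system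 encodes the Einstein equation for a non-positively curved conformally compact Einstein metric on the $(n+1)$-ball whose conformal infinity is $[\hat g]$ with $\hat g$ an $\mathrm{Sp}(k+1)$-invariant metric on $\mathbb{S}^n$.) The dimension $n$ is fixed; constants may depend on it. *)

(* Defs.v *)
From Stdlib Require Export Reals ClassicalEpsilon List Permutation.
Export ListNotations.
Open Scope R_scope.

Definition unit_interval (x : R) : Prop := 0 <= x <= 1.

(* The derivative within [0,1]: two-sided on (0,1), one-sided at 0 and at 1.
   [D_in] only uses the value of its second argument at the base point, hence
   the constant function.  The value is unspecified where no derivative exists. *)
Definition deriv (f : R -> R) (x : R) : R :=
  epsilon (inhabits 0) (fun l => D_in f (fun _ => l) unit_interval x).

Definition deriv_n (k : nat) (f : R -> R) : R -> R := Nat.iter k deriv f.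

(* f is of class C^oo on the closed interval [0,1]. *)
Definition smooth01 (f : R -> R) : Prop :=
  forall (k : nat) (x : R), unit_interval x ->
    exists l, D_in (deriv_n k f) (fun _ => l) unit_interval x.

(* The unknowns y_1, ..., y_4 are y 1, ..., y 4; other indices are never used. *)
Definition Kfun (y : nat -> R -> R) (x : R) : R := exp (y 1%nat x).
Definition tfun (y : nat -> R -> R) (i : nat) (x : R) : R := exp (y (S i) x).

Definition Pfun (n : nat) (y : nat -> R -> R) (x : R) : R :=
  Rpower (/ Kfun y x * tfun y 1 x * tfun y 2 x * tfun y 3 x) (1 / INR n).

Definition Psi (n : nat) (y : nat -> R -> R) (x : R) : R :=
  let d2 := deriv (y 2%nat) x in
  let d3 := deriv (y 3%nat) x in
  let d4 := deriv (y 4%nat) x in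
  ((INR n - 1) * d2 - d3 - d4) ^ 2
  + (- d2 + (INR n - 1) * d3 - d4) ^ 2
  + (- d2 - d3 + (INR n - 1) * d4) ^ 2
  + (INR n - 3) * (d2 + d3 + d4) ^ 2.

Definition eq_K1 (n : nat) (y : nat -> R -> R) (x : R) : Prop :=
  deriv_n 2 (y 1%nat) x
  - (1 + 3 * x ^ 2) / (x * (1 - x ^ 2)) * deriv (y 1%nat) x
  + 1 / (2 * INR n ^ 2) * (INR n * deriv (y 1%nat) x ^ 2 + Psi n y x) = 0.

Definition eq_K2 (n : nat) (y : nat -> R -> R) (x : R) : Prop :=
  let t1 := tfun y 1 x in
  let t2 := tfun y 2 x in
  let t3 := tfun y 3 x in
  deriv_n 2 (y 1%nat) x
  - (2 * INR n - 1 + (2 * INR n + 1) * x ^ 2) / (x * (1 - x ^ 2))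
      * deriv (y 1%nat) x
  + 1 / 2 * deriv (y 1%nat) x ^ 2
  + 8 / (1 - x ^ 2) ^ 2
    * (INR n * (INR n - 1)
       - Pfun n y x
         * ((INR n - 3) * (INR n + 5)
            - (INR n - 3) * (t1 + t2 + t3)
            + 2 * (2 * t1 * t2 + 2 * t1 * t3 + 2 * t2 * t3
                   - t1 ^ 2 - t2 ^ 2 - t3 ^ 2) / (t1 * t2 * t3))) = 0.

Definition eq_t (n : nat) (y : nat -> R -> R) (a b c : nat) (x : R) : Prop :=
  let ta := tfun y a x in
  let tb := tfun y b x in
  let tc := tfun y c x in
  deriv_n 2 (y (S a)) x
  - (INR n - 1 + (INR n + 1) * x ^ 2) / (x * (1 - x ^ 2)) * deriv (y (S a)) x
  + 1 / 2 * deriv (y 1%nat) x * deriv (y (S a)) x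
  - 8 * Pfun n y x / (1 - x ^ 2) ^ 2
    * ((INR n - 1) * ta + 2 * tb + 2 * tc - INR n - 5
       + 2 * (ta ^ 2 - (tb - tc) ^ 2) / (ta * tb * tc)) = 0.

(* {a,b,c} = {1,2,3} *)
Definition is_123 (a b c : nat) : Prop := Permutation [a; b; c] [1; 2; 3]%nat.

(* y solves the boundary value problem with prescribed data t_i(0) = phi i. *)
Record BVP (n : nat) (phi : nat -> R) (y : nat -> R -> R) : Prop := {
  bvp_smooth : forall j, (1 <= j <= 4)%nat -> smooth01 (y j);
  bvp_K1 : forall x, 0 < x < 1 -> eq_K1 n y x;
  bvp_K2 : forall x, 0 < x < 1 -> eq_K2 n y x;
  bvp_t : forall a b c, is_123 a b c -> forall x, 0 < x < 1 -> eq_t n y a b c x;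
  bvp_phi_pos : forall i, (1 <= i <= 3)%nat -> 0 < phi i;
  bvp_t0 : forall i, (1 <= i <= 3)%nat -> tfun y i 0 = phi i;
  bvp_K_1 : Kfun y 1 = 1;
  bvp_t_1 : forall i, (1 <= i <= 3)%nat -> tfun y i 1 = 1;
  bvp_deriv_0 : forall j, (1 <= j <= 4)%nat -> deriv (y j) 0 = 0;
  bvp_deriv_1 : forall j, (1 <= j <= 4)%nat -> deriv (y j) 1 = 0
}.

Record admissible_data (n : nat) (sigma tau : R) (phi : nat -> R) : Prop := {
  adm_bounds : forall i, (1 <= i <= 3)%nat ->
    sigma < phi i < (INR n + 5) / 3;
  adm_order : phi 1%nat >= phi 2%nat /\ phi 2%nat >= phi 3%nat;
  adm_triangle : forall i j k, is_123 i j k -> / phi i * (phi j + phi k) > 1;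
  adm_tau : forall C13 C23 : R,
    1 <= C13 <= phi 1%nat / phi 3%nat ->
    1 <= C23 <= phi 2%nat / phi 3%nat ->
    2 * C13 * C23 + 2 * C13 + 2 * C23 - C13 ^ 2 - C23 ^ 2 - 1 > tau
}.

(* On [0,b], |y_i'(x)| <= C x and |y_i''(x)| <= C for i = 1, ..., 4
   (at x = 0, x^0 = 1). *)
Definition deriv_estimate (y : nat -> R -> R) (b C : R) : Prop :=
  forall k i : nat, (1 <= k <= 2)%nat -> (1 <= i <= 4)%nat ->
  forall x : R, 0 <= x <= b -> Rabs (deriv_n k (y i) x) <= C * x ^ (2 - k).

(* Main.v *)
Require Import Defs.
From Stdlib Require Import Reals Lra Lia.
From Coquelicot Require Import Coquelicot.
Open Scope R_scope.

(** The argument rests on one monotone quantity, the energy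
    W(x) = (1-x^2)^2 y_1'(x) / x.

    The first equation for y_1 says that W' is minus (1-x^2)^2/x times a
    positive definite quadratic form in the y_j' ([energy_derive]).  Hence W
    decreases from y_1''(0) at x = 0 to 0 at x = 1.  Subtracting the two
    equations for y_1 gives a first-order constraint ([Psi_constraint]), whose
    limit at 0 is (n-1) y_1''(0) = 4 (n(n-1) - P(0) S(0)), with S the scalar
    curvature of the conformal infinity up to normalization
    ([y1_deriv2_0_eq]).  The hypotheses on the initial data bound S(0) below by
    a positive constant depending on n, sigma and tau
    ([sphere_scal_initial_ge]).  Two conclusions follow: y_1''(0) <= 4n, so that
    0 <= W <= 4n, which is the estimate for y_1'; and, as y_1''(0) >= 0,
    P(0) <= n(n-1)/S(0) is bounded.

    The total decrease of W is at most 4n, so the y_a' with a = 2, 3, 4 are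
    square integrable with weight (1-x^2)^2/x.  By the Cauchy-Schwarz
    inequality, used here in the pointwise form of Young's inequality, the
    functions y_a stay at bounded distance from their initial values on [0,b]
    for every b < 1 ([displacement_le]).  So the t_i are bounded above and away
    from zero there, and P is bounded ([uniform_t_P_bounds]).  The constraint
    now bounds Psi, hence the y_a' ([uniform_Psi_bound]).  Finally the equation
    for y_a reads y_a'' - (n-1) y_a'/x = bounded, and integration with the factor
    x^(1-n) from b down to x gives |y_a'| <= C x ([linear_bound],
    [log_t_bounds]); the second derivatives are then read off the equations. *)

(** * Derivatives and limits on the unit interval *)

Lemma smooth_D_in f k x :
  smooth01 f -> 0 <= x <= 1 ->
  D_in (deriv_n k f) (fun _ => deriv_n (S k) f x) unit_interval x.
Proof.
  intros Hf Hx.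
  exact (epsilon_spec (inhabits 0)
    (fun l => D_in (deriv_n k f) (fun _ => l) unit_interval x) (Hf k x Hx)).
Qed.

Lemma smooth_is_derive f k x :
  smooth01 f -> 0 < x < 1 -> is_derive (deriv_n k f) x (deriv_n (S k) f x).
Proof.
  intros Hf Hx. apply is_derive_Reals. intros eps Heps.
  assert (Hx' : 0 <= x <= 1) by lra.
  destruct (smooth_D_in f k x Hf Hx' eps Heps) as [alp [Halp H]].
  assert (Hd : 0 < Rmin alp (Rmin x (1 - x))).
  { repeat apply Rmin_glb_lt; lra. }
  exists (mkposreal _ Hd). intros h Hh Hlt. simpl in Hlt.
  assert (H1 := Rmin_l alp (Rmin x (1 - x))).
  assert (H2 := Rmin_r alp (Rmin x (1 - x))).
  assert (H3 := Rmin_l x (1 - x)). assert (H4 := Rmin_r x (1 - x)).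
  assert (Hb := Rabs_def2 h _ Hlt).
  specialize (H (x + h)). simpl in H. unfold R_dist in H.
  replace (x + h - x) with h in H by ring.
  apply H. split.
  - split; [unfold unit_interval; lra | lra].
  - lra.
Qed.

Lemma limit1_in_at_right_0 g l :
  limit1_in g (D_x unit_interval 0) l 0 -> filterlim g (at_right 0) (locally l).
Proof.
  intros H. apply filterlim_locally. intros eps.
  destruct (H eps (cond_pos eps)) as [alp [Halp Hg]].
  assert (Hd : 0 < Rmin alp 1) by (apply Rmin_glb_lt; lra).
  exists (mkposreal _ Hd). intros x Hx Hx0.
  assert (H1 := Rmin_l alp 1). assert (H2 := Rmin_r alp 1).
  change (Rabs (x - 0) < Rmin alp 1) in Hx.
  assert (Hb := Rabs_def2 _ _ Hx).
  apply Hg. split.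
  - split; [unfold unit_interval; lra | lra].
  - simpl; unfold R_dist; lra.
Qed.

Lemma limit1_in_at_left_1 g l :
  limit1_in g (D_x unit_interval 1) l 1 -> filterlim g (at_left 1) (locally l).
Proof.
  intros H. apply filterlim_locally. intros eps.
  destruct (H eps (cond_pos eps)) as [alp [Halp Hg]].
  assert (Hd : 0 < Rmin alp 1) by (apply Rmin_glb_lt; lra).
  exists (mkposreal _ Hd). intros x Hx Hx0.
  assert (H1 := Rmin_l alp 1). assert (H2 := Rmin_r alp 1).
  change (Rabs (x - 1) < Rmin alp 1) in Hx.
  assert (Hb := Rabs_def2 _ _ Hx).
  apply Hg. split.
  - split; [unfold unit_interval; lra | lra].
  - simpl; unfold R_dist; lra.
Qed.

Lemma smooth_at_right_0 f k :
  smooth01 f -> filterlim (deriv_n k f) (at_right 0) (locally (deriv_n k f 0)).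
Proof.
  intros Hf. apply limit1_in_at_right_0.
  refine (cont_deriv _ _ _ 0 (smooth_D_in f k 0 Hf _)); lra.
Qed.

Lemma smooth_at_left_1 f k :
  smooth01 f -> filterlim (deriv_n k f) (at_left 1) (locally (deriv_n k f 1)).
Proof.
  intros Hf. apply limit1_in_at_left_1.
  refine (cont_deriv _ _ _ 1 (smooth_D_in f k 1 Hf _)); lra.
Qed.

Lemma smooth_quotient_at_right_0 f :
  smooth01 f -> deriv f 0 = 0 ->
  filterlim (fun x => deriv f x / x) (at_right 0) (locally (deriv_n 2 f 0)).
Proof.
  intros Hf H0.
  apply filterlim_ext with (fun x => (deriv f x - deriv f 0) / (x - 0)).
  { intros x. rewrite H0, !Rminus_0_r. reflexivity. }
  apply limit1_in_at_right_0.
  refine (smooth_D_in f 1 0 Hf _); lra.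
Qed.

(** * Algebra of limits along a filter *)

Lemma lim_plus {F : (R -> Prop) -> Prop} {FF : Filter F} (f g : R -> R) a b :
  filterlim f F (locally a) -> filterlim g F (locally b) ->
  filterlim (fun x => f x + g x) F (locally (a + b)).
Proof.
  intros Hf Hg.
  exact (filterlim_comp_2 _ _ _ Hf Hg (filterlim_plus (V := R_NormedModule) a b)).
Qed.
Lemma lim_mult {F : (R -> Prop) -> Prop} {FF : Filter F} (f g : R -> R) a b :
  filterlim f F (locally a) -> filterlim g F (locally b) ->
  filterlim (fun x => f x * g x) F (locally (a * b)).
Proof.
  intros Hf Hg.
  exact (filterlim_comp_2 _ _ _ Hf Hg (filterlim_mult (K := R_AbsRing) a b)).
Qed.
Lemma lim_comp {F : (R -> Prop) -> Prop} {FF : Filter F} (f g : R -> R) a :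
  filterlim f F (locally a) -> continuous g a ->
  filterlim (fun x => g (f x)) F (locally (g a)).
Proof. intros Hf Hg. exact (filterlim_comp _ _ _ f g _ _ _ Hf Hg). Qed.
Lemma lim_opp {F : (R -> Prop) -> Prop} {FF : Filter F} (f : R -> R) a :
  filterlim f F (locally a) -> filterlim (fun x => - f x) F (locally (- a)).
Proof. 
  intros Hf. apply (lim_comp f Ropp a Hf).
  apply continuity_pt_filterlim. reg.
Qed.
Lemma lim_minus {F : (R -> Prop) -> Prop} {FF : Filter F} (f g : R -> R) a b :
  filterlim f F (locally a) -> filterlim g F (locally b) ->
  filterlim (fun x => f x - g x) F (locally (a - b)).
Proof.
  intros Hf Hg. apply lim_plus; [exact Hf | exact (lim_opp g b Hg)].
Qed.
Lemma lim_div {F : (R -> Prop) -> Prop} {FF : Filter F} (f g : R -> R) a b :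
  b <> 0 ->
  filterlim f F (locally a) -> filterlim g F (locally b) ->
  filterlim (fun x => f x / g x) F (locally (a / b)).
Proof.
  intros Hb Hf Hg. apply lim_mult; [exact Hf|].
  apply (lim_comp g Rinv b Hg).
  apply (continuous_Rinv b Hb).
Qed.
Lemma lim_pow {F : (R -> Prop) -> Prop} {FF : Filter F} (f : R -> R) a k :
  filterlim f F (locally a) -> filterlim (fun x => f x ^ k) F (locally (a ^ k)).
Proof.
  intros Hf. apply (lim_comp f (fun u => u ^ k) a Hf).
  apply continuity_pt_filterlim. reg.
Qed.
Lemma lim_exp {F : (R -> Prop) -> Prop} {FF : Filter F} (f : R -> R) a :
  filterlim f F (locally a) -> filterlim (fun x => exp (f x)) F (locally (exp a)).
Proof.
  intros Hf. apply (lim_comp f exp a Hf).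
  apply continuity_pt_filterlim. reg.
Qed.

Lemma lim_id_at_right (x0 : R) : filterlim (fun x : R => x) (at_right x0) (locally x0).
Proof. intros P HP. unfold filtermap. revert HP. apply filter_le_within. Qed.
Lemma lim_id_at_left (x0 : R) : filterlim (fun x : R => x) (at_left x0) (locally x0).
Proof. intros P HP. unfold filtermap. revert HP. apply filter_le_within. Qed.

Lemma near_right_0 (b : R) : 0 < b -> at_right 0 (fun x => 0 < x <= b).
Proof.
  intros Hb. exists (mkposreal b Hb). intros x Hx Hx0.
  change (Rabs (x - 0) < b) in Hx. apply Rabs_def2 in Hx. lra.
Qed.
Lemma near_left_1 (b : R) : b < 1 -> at_left 1 (fun x => b <= x < 1).
Proof.
  intros Hb. assert (H : 0 < 1 - b) by lra.
  exists (mkposreal _ H). intros x Hx Hx0.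
  change (Rabs (x - 1) < 1 - b) in Hx. apply Rabs_def2 in Hx. lra.
Qed.

Lemma lim_ge {F} {FF : ProperFilter F} (f : R -> R) l c :
  F (fun x => c <= f x) -> filterlim f F (locally l) -> c <= l.
Proof.
  intros H Hf.
  exact (filterlim_le (fun _ => c) f (Finite c) (Finite l) H
           (filterlim_const c) Hf).
Qed.
Lemma lim_le {F} {FF : ProperFilter F} (f : R -> R) l c :
  F (fun x => f x <= c) -> filterlim f F (locally l) -> l <= c.
Proof.
  intros H Hf.
  exact (filterlim_le f (fun _ => c) (Finite l) (Finite c) H
           Hf (filterlim_const c)).
Qed.

(** * Monotonicity and a singular first-order inequality *)

Lemma decreasing_of_derive (f df : R -> R) a b :
  a <= b -> (forall x, a <= x <= b -> is_derive f x (df x)) ->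
  (forall x, a <= x <= b -> df x <= 0) -> f b <= f a.
Proof.
  intros Hab Hd Hle.
  destruct (MVT_gen f a b df) as [c [Hc Heq]].
  - rewrite Rmin_left, Rmax_right by lra. intros x Hx. apply Hd; lra.
  - rewrite Rmin_left, Rmax_right by lra. intros x Hx.
    apply continuity_pt_filterlim. apply (ex_derive_continuous f x).
    exists (df x). apply Hd; lra.
  - rewrite Rmin_left, Rmax_right in Hc by lra.
    specialize (Hle c Hc). nra.
Qed.

(** The integrating factor of f' - (j+1) f / x is x^-(j+1).  As j >= 1, the
    factor times a source bounded by M integrates from x to b to at most
    M x^-j, so that undoing the factor leaves M x, while the boundary value at
    b contributes (x/b)^(j+1) B <= (x/b) B.  This turns a mere bound on f into
    the linear decay at 0. *)
Lemma linear_lower_bound (f df : R -> R) (j : nat) (b M B : R) :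
  (1 <= j)%nat -> 0 < b -> 0 <= M ->
  (forall x, 0 < x <= b -> is_derive f x (df x)) ->
  (forall x, 0 < x <= b -> df x - INR (S j) / x * f x <= M) ->
  f b >= - B -> 0 <= B ->
  forall x, 0 < x <= b -> f x >= - ((B / b + M) * x).
Proof.
  intros Hj Hb HM Hd HG HB HB0 x Hx.
  assert (Hj1 : 1 <= INR j) by (apply (le_INR 1 j Hj)).
  assert (Hmon : f b / b ^ S j + M / b ^ j <= f x / x ^ S j + M / x ^ j).
  { apply (decreasing_of_derive (fun s => f s / s ^ S j + M / s ^ j)
      (fun s => (df s - INR (S j) / s * f s - M * INR j) / s ^ S j)); [lra| |].
    - intros s Hs. assert (Hs0 : 0 < s) by lra.
      assert (Hp : s ^ j <> 0) by (apply pow_nonzero; lra).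
      assert (Hdf : is_derive f s (df s)) by (apply Hd; lra).
      destruct j as [|i]; [lia|].
      assert (Hp' : s ^ i <> 0) by (apply pow_nonzero; lra).
      auto_derive.
      + repeat split; auto. exists (df s); exact Hdf.
        simpl; apply Rmult_integral_contrapositive_currified; [lra|]. 
        apply Rmult_integral_contrapositive_currified; lra.
      + replace (Derive (fun x0 => f x0) s) with (df s)
          by (symmetry; apply is_derive_unique; exact Hdf).
        simpl.
        change (match i with O => 1 | S _ => INR i + 1 end) with (INR (S i)).
        field. split; [lra | exact Hp'].
    - intros s Hs. assert (Hs0 : 0 < s) by lra.
      assert (Hp : 0 < s ^ S j) by (apply pow_lt; lra).
      assert (H := HG s ltac:(lra)).
      apply Rmult_le_reg_r with (s ^ S j); [exact Hp|].
      unfold Rdiv at 1. rewrite Rmult_assoc, Rinv_l, Rmult_0_l by lra. nra. }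
  assert (Hxp : 0 < x ^ j) by (apply pow_lt; lra).
  assert (Hbp : 0 < b ^ j) by (apply pow_lt; lra).
  assert (Hpow : x ^ j <= b ^ j) by (apply pow_incr; lra).
  assert (HMb : 0 <= M / b ^ j).
  { apply Rmult_le_pos; [lra | left; apply Rinv_0_lt_compat; lra]. }
  assert (HBb : - (B / b / b ^ j) <= f b / b ^ S j).
  { simpl. replace (- (B / b / b ^ j)) with (- B / (b * b ^ j)) by (field; lra).
    apply Rmult_le_compat_r; [|lra].
    left; apply Rinv_0_lt_compat; nra. }
  assert (HBx : B / b / b ^ j <= B / b / x ^ j).
  { apply Rmult_le_compat_l.
    - apply Rmult_le_pos; [lra | left; apply Rinv_0_lt_compat; lra].
    - apply Rinv_le_contravar; lra. }
  assert (Hfin : - (B / b / x ^ j) - M / x ^ j <= f x / x ^ S j) by lra.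
  replace (f x) with (f x / x ^ S j * (x * x ^ j)) by (simpl; field; lra).
  replace (- ((B / b + M) * x)) with
    ((- (B / b / x ^ j) - M / x ^ j) * (x * x ^ j)) by (field; lra).
  apply Rle_ge, Rmult_le_compat_r; [nra | exact Hfin].
Qed.

Lemma linear_bound (f df : R -> R) (j : nat) (b M B : R) :
  (1 <= j)%nat -> 0 < b ->
  (forall x, 0 < x <= b -> is_derive f x (df x)) ->
  (forall x, 0 < x <= b -> Rabs (df x - INR (S j) / x * f x) <= M) ->
  Rabs (f b) <= B ->
  forall x, 0 < x <= b -> Rabs (f x) <= (B / b + M) * x.
Proof.
  intros Hj Hb Hd HG HB x Hx.
  assert (HM : 0 <= M).
  { apply Rle_trans with (2 := HG b ltac:(lra)). apply Rabs_pos. }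
  assert (HB0 : 0 <= B) by (apply Rle_trans with (2 := HB); apply Rabs_pos).
  apply Rabs_le_between in HB.
  apply Rabs_le_between. split.
  - apply Rge_le.
    apply (linear_lower_bound f df j b M B Hj Hb HM Hd); try lra.
    intros s Hs. specialize (HG s Hs). apply Rabs_le_between in HG. lra.
  - assert (H : - f x >= - ((B / b + M) * x)); [|lra].
    apply (linear_lower_bound (fun s => - f s) (fun s => - df s) j b M B Hj Hb HM);
      try lra.
    + intros s Hs. apply (is_derive_opp f s (df s)), Hd, Hs.
    + intros s Hs. specialize (HG s Hs). apply Rabs_le_between in HG. lra.
Qed.

(** * The monotone quantity and the curvature constraint *)

(** The scalar curvature, up to normalization, of the homogeneous metric on the
    sphere whose parameters are a, b, c. *)
Definition sphere_scal (N a b c : R) : R :=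
  (N - 3) * (N + 5) - (N - 3) * (a + b + c)
  + 2 * (2 * a * b + 2 * a * c + 2 * b * c - a ^ 2 - b ^ 2 - c ^ 2) / (a * b * c).

Definition weighted_scal (n : nat) (y : nat -> R -> R) (x : R) : R :=
  Pfun n y x * sphere_scal (INR n) (tfun y 1 x) (tfun y 2 x) (tfun y 3 x).

(** The factor (1 - x^2)^2 / x is the integrating factor of the linear part of
    the first equation for y_1. *)
Definition energy (y : nat -> R -> R) (x : R) : R :=
  (1 - x ^ 2) ^ 2 * (deriv (y 1%nat) x / x).

Lemma Pfun_exp n y x :
  Pfun n y x = exp (1 / INR n * (- y 1%nat x + y 2%nat x + y 3%nat x + y 4%nat x)).
Proof.
  unfold Pfun, Rpower, Kfun, tfun.
  rewrite <- exp_Ropp, <- !exp_plus, ln_exp. reflexivity.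
Qed.

Lemma Pfun_pos n y x : 0 < Pfun n y x.
Proof. rewrite Pfun_exp. apply exp_pos. Qed.

(** Psi = n (n-3) |d|^2 + n (sum of squared differences of the d_i), and
    n (n-3) >= n^2 / 2 once n >= 6. *)
Lemma Psi_ge n y a x :
  7 <= INR n -> (2 <= a <= 4)%nat -> INR n ^ 2 / 2 * deriv (y a) x ^ 2 <= Psi n y x.
Proof.
  intros HN Ha. unfold Psi. set (N := INR n) in *.
  assert (Ha' : a = 2%nat \/ a = 3%nat \/ a = 4%nat) by lia.
  set (p := deriv (y 2%nat) x); set (q := deriv (y 3%nat) x);
    set (r := deriv (y 4%nat) x).
  match goal with |- _ <= ?E =>
    replace E with (N * (N - 3) * (p ^ 2 + q ^ 2 + r ^ 2)
      + N * ((p - q) ^ 2 + (p - r) ^ 2 + (q - r) ^ 2)) by ring end.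
  assert (H0 : 0 <= N * ((p - q) ^ 2 + (p - r) ^ 2 + (q - r) ^ 2)).
  { apply Rmult_le_pos; [lra|].
    assert (H1 := pow2_ge_0 (p - q)). assert (H2 := pow2_ge_0 (p - r)).
    assert (H3 := pow2_ge_0 (q - r)). lra. }
  assert (HNN : N ^ 2 / 2 <= N * (N - 3)) by nra.
  assert (HN0 : 0 <= N * (N - 3)) by nra.
  assert (Hp := pow2_ge_0 p). assert (Hq := pow2_ge_0 q).
  assert (Hr := pow2_ge_0 r).
  assert (H : forall u, 0 <= u ^ 2 -> u ^ 2 <= p ^ 2 + q ^ 2 + r ^ 2 ->
     N ^ 2 / 2 * u ^ 2 <= N * (N - 3) * (p ^ 2 + q ^ 2 + r ^ 2)).
  { intros u Hu0 Hu. assert (0 <= N ^ 2) by apply pow2_ge_0. apply Rmult_le_compat; lra. }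
  destruct Ha' as [-> | [-> | ->]]; [fold p | fold q | fold r].
  - specialize (H p); lra.
  - specialize (H q); lra.
  - specialize (H r); lra.
Qed.

Lemma Psi_nonneg n y x : 7 <= INR n -> 0 <= Psi n y x.
Proof.
  intros HN. assert (H := Psi_ge n y 2 x HN ltac:(lia)).
  assert (H2 := pow2_ge_0 (deriv (y 2%nat) x)). nra.
Qed.

(** In divergence form the first equation for y_1 exhibits the energy as
    decreasing, with a dissipation that controls every first derivative. *)
Lemma energy_derive n phi y x :
  BVP n phi y -> 0 < x < 1 ->
  is_derive (energy y) x
    (- ((1 - x ^ 2) ^ 2 / x
        * (1 / (2 * INR n ^ 2) * (INR n * deriv (y 1%nat) x ^ 2 + Psi n y x)))).
Proof.
  intros HB Hx.
  assert (Hd := smooth_is_derive (y 1%nat) 1 x (bvp_smooth _ _ _ HB 1%nat ltac:(lia)) Hx).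
  assert (He := bvp_K1 _ _ _ HB x Hx). unfold eq_K1 in He.
  change (deriv_n 1 (y 1%nat)) with (deriv (y 1%nat)) in Hd.
  set (Q := 1 / (2 * INR n ^ 2) * _) in *.
  unfold energy.
  set (f := deriv (y 1%nat)) in *.
  replace Q with ((1 + 3 * x ^ 2) / (x * (1 - x ^ 2)) * f x - deriv_n 2 (y 1%nat) x) by lra.
  auto_derive.
  - repeat split; [eexists; exact Hd | lra].
  - replace (Derive (fun x0 => f x0) x) with (deriv_n 2 (y 1%nat) x)
      by (symmetry; apply is_derive_unique; exact Hd).
    field. split; nra.
Qed.

Lemma energy_at_right_0 n phi y :
  BVP n phi y -> filterlim (energy y) (at_right 0) (locally (deriv_n 2 (y 1%nat) 0)).
Proof.
  intros HB. unfold energy.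
  replace (deriv_n 2 (y 1%nat) 0)
    with ((1 - 0 ^ 2) ^ 2 * deriv_n 2 (y 1%nat) 0) by ring.
  apply lim_mult.
  - apply lim_pow, lim_minus; [apply filterlim_const | apply lim_pow, lim_id_at_right].
  - apply smooth_quotient_at_right_0;
      [apply (bvp_smooth _ _ _ HB) | apply (bvp_deriv_0 _ _ _ HB)]; lia.
Qed.

Lemma energy_at_left_1 n phi y :
  BVP n phi y -> filterlim (energy y) (at_left 1) (locally 0).
Proof.
  intros HB. unfold energy.
  replace 0 with ((1 - 1 ^ 2) ^ 2 * (deriv (y 1%nat) 1 / 1)) at 1 by field.
  apply lim_mult.
  - apply lim_pow, lim_minus; [apply filterlim_const | apply lim_pow, lim_id_at_left].
  - apply lim_div; [lra | | apply lim_id_at_left].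
    apply (smooth_at_left_1 (y 1%nat) 1), (bvp_smooth _ _ _ HB); lia.
Qed.

Lemma energy_decreasing n phi y x z :
  7 <= INR n -> BVP n phi y -> 0 < x -> x <= z -> z < 1 -> energy y z <= energy y x.
Proof.
  intros HN HB Hx Hxz Hz.
  apply (decreasing_of_derive (energy y)
   (fun x => - ((1 - x ^ 2) ^ 2 / x
        * (1 / (2 * INR n ^ 2) * (INR n * deriv (y 1%nat) x ^ 2 + Psi n y x)))) x z Hxz).
  - intros s Hs. apply (energy_derive n phi y s HB). lra.
  - intros s Hs.
    assert (HPsi := Psi_ge n y 2 s HN ltac:(lia)).
    assert (H2 := pow2_ge_0 (deriv (y 1%nat) s)).
    assert (H3 := pow2_ge_0 (deriv (y 2%nat) s)).
    assert (HN2 : 0 < INR n ^ 2) by nra.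
    assert (H1 : 0 <= (1 - s ^ 2) ^ 2 / s).
    { apply Rmult_le_pos; [apply pow2_ge_0 | left; apply Rinv_0_lt_compat; lra]. }
    assert (H4 : 0 <= 1 / (2 * INR n ^ 2)).
    { left; apply Rdiv_lt_0_compat; lra. }
    assert (H5 : 0 <= INR n * deriv (y 1%nat) s ^ 2 + Psi n y s) by nra.
    assert (H6 := Rmult_le_pos _ _ H1 (Rmult_le_pos _ _ H4 H5)). lra.
Qed.

(** The weight (1 - x^2)^2 makes the energy vanish at 1, so a decreasing energy
    is nonnegative. *)
Lemma energy_nonneg n phi y x :
  7 <= INR n -> BVP n phi y -> 0 < x < 1 -> 0 <= energy y x.
Proof.
  intros HN HB Hx. apply (lim_le (energy y) 0 _ (F := at_left 1)).
  - apply (filter_imp (fun s => x <= s < 1)); [|apply near_left_1; lra].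
    intros s Hs. apply (energy_decreasing n phi); try assumption; lra.
  - exact (energy_at_left_1 n phi y HB).
Qed.

Lemma energy_le n phi y x :
  7 <= INR n -> BVP n phi y -> 0 < x < 1 -> energy y x <= deriv_n 2 (y 1%nat) 0.
Proof.
  intros HN HB Hx. apply (lim_ge (energy y) _ _ (F := at_right 0)).
  - apply (filter_imp (fun s => 0 < s <= x)); [|apply near_right_0; lra].
    intros s Hs. apply (energy_decreasing n phi); try assumption; lra.
  - exact (energy_at_right_0 n phi y HB).
Qed.

(** The two equations for y_1 have the same second-order term: their difference
    is a first-order relation, the Gauss equation of the level sets. *)
Lemma Psi_constraint n phi y x :
  7 <= INR n -> BVP n phi y -> 0 < x < 1 ->
  Psi n y x / (2 * INR n ^ 2)
  = (INR n - 1) / (2 * INR n) * deriv (y 1%nat) x ^ 2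
    - 2 * (INR n - 1) * (1 + x ^ 2) / (1 - x ^ 2) * (deriv (y 1%nat) x / x)
    + 8 / (1 - x ^ 2) ^ 2 * (INR n * (INR n - 1) - weighted_scal n y x).
Proof.
  intros HN HB Hx.
  assert (H1 := bvp_K1 _ _ _ HB x Hx). assert (H2 := bvp_K2 _ _ _ HB x Hx).
  unfold eq_K1 in H1. unfold eq_K2 in H2. cbv zeta in H2.
  unfold weighted_scal, sphere_scal.
  set (G := 8 / _ * _) in H2. fold G.
  set (f := deriv (y 1%nat) x) in *. set (f2 := deriv_n 2 (y 1%nat) x) in *.
  assert (E : f2 = (2 * INR n - 1 + (2 * INR n + 1) * x ^ 2) / (x * (1 - x ^ 2)) * f
    - 1 / 2 * f ^ 2 - G) by lra.
  rewrite E in H1.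
  match type of H1 with ?A = 0 =>
    match goal with |- ?L = ?R => assert (E2 : A = L - R) end end.
  { clearbody G. field. repeat split; nra. }
  lra.
Qed.

(** Reduces a limit at 0 of an explicit formula to limits of its atoms.  A
    quotient of a derivative by x is kept whole: its denominator tends to 0. *)
Ltac lim_algebra :=
  lazymatch goal with
  | |- filterlim (fun x => deriv _ x / x) _ _ => idtac
  | |- filterlim (fun x => x) _ _ => apply lim_id_at_right
  | |- filterlim (fun x => _ + _) _ _ => apply lim_plus; lim_algebra
  | |- filterlim (fun x => _ - _) _ _ => apply lim_minus; lim_algebra
  | |- filterlim (fun x => - _) _ _ => apply lim_opp; lim_algebra
  | |- filterlim (fun x => _ * _) _ _ => apply lim_mult; lim_algebra
  | |- filterlim (fun x => _ / _) _ _ => apply lim_div; lim_algebra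
  | |- filterlim (fun x => _ ^ _) _ _ => apply lim_pow; lim_algebra
  | |- filterlim (fun x => _) _ _ => first [apply filterlim_const | idtac]
  | |- _ => idtac
  end.

Lemma tfun_at_right_0 n phi y i :
  BVP n phi y -> (1 <= i <= 3)%nat ->
  filterlim (tfun y i) (at_right 0) (locally (tfun y i 0)).
Proof.
  intros HB Hi. apply lim_exp.
  apply (smooth_at_right_0 _ 0), (bvp_smooth _ _ _ HB); lia.
Qed.

Lemma deriv_at_right_0 n phi y i :
  BVP n phi y -> (1 <= i <= 4)%nat ->
  filterlim (deriv (y i)) (at_right 0) (locally 0).
Proof.
  intros HB Hi. replace 0 with (deriv (y i) 0) at 2 by exact (bvp_deriv_0 _ _ _ HB i Hi).
  apply (smooth_at_right_0 (y i) 1), (bvp_smooth _ _ _ HB); lia.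
Qed.

Lemma weighted_scal_at_right_0 n phi y :
  BVP n phi y -> filterlim (weighted_scal n y) (at_right 0) (locally (weighted_scal n y 0)).
Proof.
  intros HB.
  assert (Hy : forall i, (1 <= i <= 4)%nat ->
    filterlim (y i) (at_right 0) (locally (y i 0))).
  { intros i Hi. apply (smooth_at_right_0 _ 0), (bvp_smooth _ _ _ HB); lia. }
  assert (Ht : forall i, (1 <= i <= 3)%nat ->
    filterlim (tfun y i) (at_right 0) (locally (tfun y i 0))).
  { intros i. exact (tfun_at_right_0 n phi y i HB). }
  unfold weighted_scal, sphere_scal. apply lim_mult.
  - apply filterlim_ext with (fun x =>
      exp (1 / INR n * (- y 1%nat x + y 2%nat x + y 3%nat x + y 4%nat x))).
    { intros x. symmetry. apply Pfun_exp. }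
    rewrite Pfun_exp. apply lim_exp, lim_mult; [apply filterlim_const|].
    repeat apply lim_plus; [apply lim_opp|..]; apply Hy; lia.
  - assert (Hne : tfun y 1 0 * tfun y 2 0 * tfun y 3 0 <> 0).
    { unfold tfun. rewrite <- !exp_plus. apply Rgt_not_eq, exp_pos. }
    lim_algebra; first [exact Hne | apply Ht; lia].
Qed.

(** The limit of the constraint at 0, where all first derivatives vanish: it
    expresses y_1''(0) through the curvature of the conformal infinity. *)
Lemma y1_deriv2_0_eq n phi y :
  7 <= INR n -> BVP n phi y ->
  (INR n - 1) * deriv_n 2 (y 1%nat) 0 = 4 * (INR n * (INR n - 1) - weighted_scal n y 0).
Proof.
  intros HN HB. set (N := INR n) in *.
  set (Phi := fun x => 
     (N - 1) / (2 * N) * deriv (y 1%nat) x ^ 2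
     - 2 * (N - 1) * (1 + x ^ 2) / (1 - x ^ 2) * (deriv (y 1%nat) x / x)
     + 8 / (1 - x ^ 2) ^ 2 * (N * (N - 1) - weighted_scal n y x)
     - Psi n y x / (2 * N ^ 2)).
  set (l := 
     (N - 1) / (2 * N) * 0 ^ 2
     - 2 * (N - 1) * (1 + 0 ^ 2) / (1 - 0 ^ 2) * deriv_n 2 (y 1%nat) 0
     + 8 / (1 - 0 ^ 2) ^ 2 * (N * (N - 1) - weighted_scal n y 0)
     - (((N - 1) * 0 - 0 - 0) ^ 2 + (- 0 + (N - 1) * 0 - 0) ^ 2
        + (- 0 - 0 + (N - 1) * 0) ^ 2 + (N - 3) * (0 + 0 + 0) ^ 2) / (2 * N ^ 2)).
  assert (Hlim : filterlim Phi (at_right 0) (locally l)).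
  { assert (Hd := fun i => deriv_at_right_0 n phi y i HB).
    assert (Hx := lim_id_at_right 0).
    assert (HP := weighted_scal_at_right_0 n phi y HB).
    assert (Hq : filterlim (fun x => deriv (y 1%nat) x / x) (at_right 0)
        (locally (deriv_n 2 (y 1%nat) 0))).
    { apply smooth_quotient_at_right_0;
        [apply (bvp_smooth _ _ _ HB) | apply (bvp_deriv_0 _ _ _ HB)]; lia. }
    unfold Phi, l, Psi. cbv zeta.
    lim_algebra; first [exact Hq | exact HP | apply Hd; lia | nra]. }
  assert (H0 : l = 0).
  { apply (filterlim_locally_unique (F := at_right 0) Phi); [exact Hlim|].
    apply (filterlim_ext_loc (fun _ => 0)); [|apply filterlim_const].
    apply (filter_imp (fun s => 0 < s <= 1 / 2)); [|apply near_right_0; lra].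
    intros x Hx. unfold Phi.
    assert (E := Psi_constraint n phi y x HN HB ltac:(lra)). fold N in E.
    rewrite E. ring. }
  unfold l in H0. 
  match type of H0 with ?A = 0 => replace A with
    (- 2 * (N - 1) * deriv_n 2 (y 1%nat) 0
     + 8 * (N * (N - 1) - weighted_scal n y 0)) in H0 end.
  - lra.
  - field. lra.
Qed.

(** * A priori bounds from the initial data *)

(** The condition t_i(0) < (n+5)/3 makes the linear part of the curvature
    nonnegative; the quadratic part is t_3/(t_1 t_2) times twice the expression
    bounded below by tau, taken at C_13 = t_1/t_3 and C_23 = t_2/t_3. *)
Lemma sphere_scal_initial_ge n sigma tau phi y :
  7 <= INR n -> 0 < sigma -> 0 < tau ->
  BVP n phi y -> admissible_data n sigma tau phi ->
  2 * tau * sigma / ((INR n + 5) / 3) ^ 2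
  <= sphere_scal (INR n) (tfun y 1 0) (tfun y 2 0) (tfun y 3 0).
Proof.
  intros HN Hs Htau HB HA.
  rewrite !(bvp_t0 _ _ _ HB) by lia.
  assert (H1 := adm_bounds _ _ _ _ HA 1%nat ltac:(lia)).
  assert (H2 := adm_bounds _ _ _ _ HA 2%nat ltac:(lia)).
  assert (H3 := adm_bounds _ _ _ _ HA 3%nat ltac:(lia)).
  destruct (adm_order _ _ _ _ HA) as [H12 H23].
  assert (Hq := adm_tau _ _ _ _ HA (phi 1%nat / phi 3%nat) (phi 2%nat / phi 3%nat)).
  set (a := phi 1%nat) in *. set (b := phi 2%nat) in *. set (c := phi 3%nat) in *.
  set (h := (INR n + 5) / 3) in *.
  assert (Hac : 1 <= a / c) by (apply Rmult_le_reg_r with c; [lra | field_simplify; lra]).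
  assert (Hbc : 1 <= b / c) by (apply Rmult_le_reg_r with c; [lra | field_simplify; lra]).
  specialize (Hq (conj Hac (Rle_refl _)) (conj Hbc (Rle_refl _))).
  set (Q := 2 * (a / c) * (b / c) + 2 * (a / c) + 2 * (b / c)
            - (a / c) ^ 2 - (b / c) ^ 2 - 1) in *.
  assert (E : sphere_scal (INR n) a b c
    = (INR n - 3) * (3 * h - (a + b + c)) + 2 * Q * c / (a * b)).
  { unfold sphere_scal, Q, h. field. lra. }
  rewrite E.
  assert (Hlin : 0 <= (INR n - 3) * (3 * h - (a + b + c))) by (apply Rmult_le_pos; lra).
  assert (Hab : 0 < a * b) by (apply Rmult_lt_0_compat; lra).
  assert (Habh : a * b <= h ^ 2) by nra.
  assert (Hfrac : 2 * tau * sigma / h ^ 2 <= 2 * Q * c / (a * b)); [|lra].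
  assert (Hnum : 2 * tau * sigma <= 2 * Q * c) by nra.
  unfold Rdiv. apply Rmult_le_compat; [nra | | exact Hnum | ].
  - left. apply Rinv_0_lt_compat. lra.
  - apply Rinv_le_contravar; assumption.
Qed.

Lemma y1_deriv2_0_nonneg n phi y :
  7 <= INR n -> BVP n phi y -> 0 <= deriv_n 2 (y 1%nat) 0.
Proof.
  intros HN HB.
  apply Rle_trans with (energy y (1 / 2)).
  - apply (energy_nonneg n phi); try assumption; lra.
  - apply (energy_le n phi); try assumption; lra.
Qed.

Lemma weighted_scal_0_le n phi y :
  7 <= INR n -> BVP n phi y -> weighted_scal n y 0 <= INR n * (INR n - 1).
Proof.
  intros HN HB. assert (H := y1_deriv2_0_eq n phi y HN HB).
  assert (H0 := y1_deriv2_0_nonneg n phi y HN HB). nra.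
Qed.

(** Since y_1''(0) >= 0, the product of P and the curvature is at most n(n-1)
    at 0; positivity of the curvature then bounds P, that is, bounds K(0) away
    from zero. *)
Lemma Pfun_0_le n sigma tau phi y :
  7 <= INR n -> 0 < sigma -> 0 < tau ->
  BVP n phi y -> admissible_data n sigma tau phi ->
  Pfun n y 0
  <= INR n * (INR n - 1) / (2 * tau * sigma / ((INR n + 5) / 3) ^ 2).
Proof.
  intros HN Hs Htau HB HA.
  assert (HS := sphere_scal_initial_ge n sigma tau phi y HN Hs Htau HB HA).
  assert (HP := weighted_scal_0_le n phi y HN HB). unfold weighted_scal in HP.
  assert (HP0 := Pfun_pos n y 0).
  set (c0 := 2 * tau * sigma / _) in *.
  assert (Hc0 : 0 < c0).
  { apply Rdiv_lt_0_compat; [|apply pow_lt; lra]. apply Rmult_lt_0_compat; lra. }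
  apply Rle_div_r; [exact Hc0 | nra].
Qed.

Lemma y1_deriv2_0_le n sigma tau phi y :
  7 <= INR n -> 0 < sigma -> 0 < tau ->
  BVP n phi y -> admissible_data n sigma tau phi ->
  deriv_n 2 (y 1%nat) 0 <= 4 * INR n.
Proof.
  intros HN Hs Htau HB HA.
  assert (HS := sphere_scal_initial_ge n sigma tau phi y HN Hs Htau HB HA).
  assert (Hc0 : 0 < 2 * tau * sigma / ((INR n + 5) / 3) ^ 2).
  { apply Rdiv_lt_0_compat; [|apply pow_lt; lra].
    repeat apply Rmult_lt_0_compat; lra. }
  assert (HP := Pfun_pos n y 0).
  assert (H := y1_deriv2_0_eq n phi y HN HB). unfold weighted_scal in H.
  nra.
Qed.

Lemma energy_bounds n sigma tau phi y x :
  7 <= INR n -> 0 < sigma -> 0 < tau ->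
  BVP n phi y -> admissible_data n sigma tau phi ->
  0 < x < 1 -> 0 <= energy y x <= 4 * INR n.
Proof.
  intros HN Hs Htau HB HA Hx. split; [apply (energy_nonneg n phi); assumption|].
  apply Rle_trans with (1 := energy_le n phi y x HN HB Hx).
  exact (y1_deriv2_0_le n sigma tau phi y HN Hs Htau HB HA).
Qed.

Lemma y1_deriv_bounds n sigma tau phi y x :
  7 <= INR n -> 0 < sigma -> 0 < tau ->
  BVP n phi y -> admissible_data n sigma tau phi ->
  0 < x < 1 -> 0 <= deriv (y 1%nat) x <= 4 * INR n / (1 - x ^ 2) ^ 2 * x.
Proof.
  intros HN Hs Htau HB HA Hx.
  assert (H := energy_bounds n sigma tau phi y x HN Hs Htau HB HA Hx).
  unfold energy in H.
  assert (Hw : 0 < (1 - x ^ 2) ^ 2) by (apply pow_lt; nra).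
  replace (deriv (y 1%nat) x)
    with ((1 - x ^ 2) ^ 2 * (deriv (y 1%nat) x / x) * (x / (1 - x ^ 2) ^ 2))
    by (field; split; nra).
  assert (Hr : 0 <= x / (1 - x ^ 2) ^ 2) by (left; apply Rdiv_lt_0_compat; lra).
  split; [apply Rmult_le_pos; lra|].
  replace (4 * INR n / (1 - x ^ 2) ^ 2 * x) with (4 * INR n * (x / (1 - x ^ 2) ^ 2))
    by (field; nra).
  apply Rmult_le_compat_r; lra.
Qed.

Lemma y1_ge_initial n phi y x :
  7 <= INR n -> BVP n phi y -> 0 < x < 1 -> y 1%nat 0 <= y 1%nat x.
Proof.
  intros HN HB Hx.
  assert (Hsm := bvp_smooth _ _ _ HB 1%nat ltac:(lia)).
  apply (lim_le (F := at_right 0) (y 1%nat) _ _); [|exact (smooth_at_right_0 _ 0 Hsm)].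
  apply (filter_imp (fun s => 0 < s <= x)); [|apply near_right_0; lra].
  intros s Hs. apply Ropp_le_cancel.
  apply (decreasing_of_derive (fun u => - y 1%nat u) (fun u => - deriv (y 1%nat) u));
    [lra| |].
  - intros u Hu. apply (is_derive_opp (y 1%nat) u (deriv (y 1%nat) u)).
    apply (smooth_is_derive _ 0 u Hsm). lra.
  - intros u Hu. assert (He := energy_nonneg n phi y u HN HB ltac:(lra)).
    unfold energy in He.
    assert (Hw : 0 < (1 - u ^ 2) ^ 2) by (apply pow_lt; nra).
    assert (Hq : 0 <= deriv (y 1%nat) u / u) by nra.
    replace (deriv (y 1%nat) u) with (deriv (y 1%nat) u / u * u) by (field; lra).
    nra.
Qed.

(** By Young's inequality, with k = (1-x^2)^2/x, the speed e y_a' is at most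
    1/(2k) + k y_a'^2/2, and the last term is dominated by twice the rate at which
    the energy decreases.  Since 1/(2k) is the derivative of
    1/(4 (1-x^2)), the auxiliary function G is decreasing.
    The sign e = 1 or -1 covers both directions. *)
Lemma signed_displacement_le n sigma tau phi y a e x :
  7 <= INR n -> 0 < sigma -> 0 < tau ->
  BVP n phi y -> admissible_data n sigma tau phi ->
  (2 <= a <= 4)%nat -> e ^ 2 = 1 -> 0 < x < 1 ->
  e * (y a x - y a 0) <= / (4 * (1 - x ^ 2)) + 8 * INR n.
Proof.
  intros HN Hs Htau HB HA Ha He Hx.
  assert (Hsm := bvp_smooth _ _ _ HB a ltac:(lia)).
  set (G := fun s => e * y a s - / (4 * (1 - s ^ 2)) + 2 * energy y s).
  assert (Hlim : filterlim G (at_right 0)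
    (locally (e * y a 0 - / (4 * (1 - 0 ^ 2)) + 2 * deriv_n 2 (y 1%nat) 0))).
  { apply lim_plus; [apply lim_minus|].
    - apply lim_mult; [apply filterlim_const | exact (smooth_at_right_0 _ 0 Hsm)].
    - apply (lim_comp (fun s => 4 * (1 - s ^ 2)) Rinv (4 * (1 - 0 ^ 2))).
      + lim_algebra.
      + apply continuous_Rinv. lra.
    - apply lim_mult; [apply filterlim_const | exact (energy_at_right_0 n phi y HB)]. }
  assert (HG : G x <= e * y a 0 - / (4 * (1 - 0 ^ 2)) + 2 * deriv_n 2 (y 1%nat) 0).
  { apply (lim_ge (F := at_right 0) G); [|exact Hlim].
    apply (filter_imp (fun s => 0 < s <= x)); [|apply near_right_0; lra].
    intros s Hsx.
    apply (decreasing_of_derive G (fun u => e * deriv (y a) u - u / (2 * (1 - u ^ 2) ^ 2)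
       + 2 * (- ((1 - u ^ 2) ^ 2 / u
        * (1 / (2 * INR n ^ 2) * (INR n * deriv (y 1%nat) u ^ 2 + Psi n y u)))))); [lra| |].
    - intros u Hu. unfold G.
      apply (is_derive_plus (fun s => e * y a s - / (4 * (1 - s ^ 2)))
        (fun s => 2 * energy y s)).
      + assert (Hd : is_derive (y a) u (deriv (y a) u)).
        { apply (smooth_is_derive _ 0 u Hsm). lra. }
        auto_derive.
        * repeat split; [eexists; exact Hd | nra].
        * replace (Derive (fun x0 => y a x0) u) with (deriv (y a) u)
            by (symmetry; apply is_derive_unique; exact Hd).
          field. nra.
      + apply (is_derive_scal (energy y)), (energy_derive n phi y u HB). lra.
    - intros u Hu.
      assert (HPsi := Psi_ge n y a u HN Ha).
      set (d := deriv (y a) u) in *.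
      assert (HN2 : 0 < INR n ^ 2) by nra.
      assert (Hw : 0 < (1 - u ^ 2) ^ 2) by (apply pow_lt; nra).
      set (w := (1 - u ^ 2) ^ 2) in *.
      assert (HQ : d ^ 2 / 4 <=
        1 / (2 * INR n ^ 2) * (INR n * deriv (y 1%nat) u ^ 2 + Psi n y u)).
      { apply Rle_trans with (1 / (2 * INR n ^ 2) * (INR n ^ 2 / 2 * d ^ 2)).
        - right. field. lra.
        - apply Rmult_le_compat_l; [left; apply Rdiv_lt_0_compat; lra|].
          assert (H1 := pow2_ge_0 (deriv (y 1%nat) u)). nra. }
      set (q := 1 / (2 * INR n ^ 2) * _) in *.
      assert (Hk : 0 < w / u) by (apply Rdiv_lt_0_compat; lra).
      assert (Hkq := Rmult_le_compat_l _ _ _ (Rlt_le _ _ Hk) HQ).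
      replace (u / (2 * w)) with (/ (2 * (w / u))) by (field; lra).
      set (k := w / u) in *.
      (* Young's inequality as a completed square; this uses e^2 = 1. *)
      assert (Hsq : / (2 * k) - e * d + k * d ^ 2 / 2 = (e - k * d) ^ 2 / (2 * k)).
      { replace ((e - k * d) ^ 2) with (e ^ 2 - 2 * k * (e * d) + k ^ 2 * d ^ 2) by ring.
        rewrite He. field. lra. }
      assert (Hpos : 0 <= (e - k * d) ^ 2 / (2 * k)).
      { apply Rmult_le_pos; [apply pow2_ge_0|].
        left; apply Rinv_0_lt_compat; lra. }
      lra. }
  unfold G in HG.
  assert (HE := energy_bounds n sigma tau phi y x HN Hs Htau HB HA Hx).
  assert (HL := y1_deriv2_0_le n sigma tau phi y HN Hs Htau HB HA).
  replace (/ (4 * (1 - 0 ^ 2))) with (1 / 4) in HG by field.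
  lra.
Qed.

Lemma displacement_le n sigma tau phi y a x :
  7 <= INR n -> 0 < sigma -> 0 < tau ->
  BVP n phi y -> admissible_data n sigma tau phi ->
  (2 <= a <= 4)%nat -> 0 < x < 1 ->
  Rabs (y a x - y a 0) <= / (4 * (1 - x ^ 2)) + 8 * INR n.
Proof.
  intros HN Hs Htau HB HA Ha Hx.
  assert (H1 := signed_displacement_le n sigma tau phi y a 1 x HN Hs Htau HB HA Ha
    ltac:(ring) Hx).
  assert (H2 := signed_displacement_le n sigma tau phi y a (-1) x HN Hs Htau HB HA Ha
    ltac:(ring) Hx).
  apply Rabs_le_between. lra.
Qed.

(** * Uniform bounds on an interval away from the centre *)

Definition ricci_bracket (N a b c : R) : R :=
  (N - 1) * a + 2 * b + 2 * c - N - 5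
  + 2 * (a ^ 2 - (b - c) ^ 2) / (a * b * c).

Lemma div_prod3_abs_le lo a b c u h :
  0 < lo -> lo <= a -> lo <= b -> lo <= c -> Rabs u <= h ->
  Rabs (u / (a * b * c)) <= h / lo ^ 3.
Proof.
  intros Hlo Ha Hb Hc Hu.
  assert (H2 : lo * lo <= a * b) by (apply Rmult_le_compat; lra).
  assert (H3 : lo ^ 3 <= a * b * c).
  { simpl. rewrite Rmult_1_r, <- Rmult_assoc. apply Rmult_le_compat; nra. }
  assert (H0 : 0 < lo ^ 3) by (apply pow_lt; lra).
  unfold Rdiv. rewrite Rabs_mult, Rabs_inv, (Rabs_pos_eq (a * b * c)) by lra.
  apply Rmult_le_compat; [apply Rabs_pos | | exact Hu |].
  - left; apply Rinv_0_lt_compat; lra.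
  - apply Rinv_le_contravar; lra.
Qed.

Lemma sphere_scal_lower N lo hi a b c :
  7 <= N -> 0 < lo -> lo <= a <= hi -> lo <= b <= hi -> lo <= c <= hi ->
  - sphere_scal N a b c <= 3 * N * hi + 18 * hi ^ 2 / lo ^ 3.
Proof.
  intros HN Hlo Ha Hb Hc. unfold sphere_scal.
  assert (H1 : Rabs (2 * (2 * a * b + 2 * a * c + 2 * b * c - a ^ 2 - b ^ 2 - c ^ 2)
     / (a * b * c)) <= 18 * hi ^ 2 / lo ^ 3).
  { apply div_prod3_abs_le; try lra. apply Rabs_le_between.
    assert (a ^ 2 <= hi ^ 2) by (apply pow_incr; lra).
    assert (b ^ 2 <= hi ^ 2) by (apply pow_incr; lra).
    assert (c ^ 2 <= hi ^ 2) by (apply pow_incr; lra).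
    assert (0 <= a * b <= hi * hi) by (split; [nra | apply Rmult_le_compat; lra]).
    assert (0 <= a * c <= hi * hi) by (split; [nra | apply Rmult_le_compat; lra]).
    assert (0 <= b * c <= hi * hi) by (split; [nra | apply Rmult_le_compat; lra]).
    assert (0 <= a ^ 2) by apply pow2_ge_0. assert (0 <= b ^ 2) by apply pow2_ge_0.
    assert (0 <= c ^ 2) by apply pow2_ge_0.
    lra. }
  apply Rabs_le_between in H1.
  assert (H2 : (N - 3) * (a + b + c) <= N * (3 * hi)) by (apply Rmult_le_compat; lra).
  assert (H3 : 0 <= (N - 3) * (N + 5)) by (apply Rmult_le_pos; lra).
  lra.
Qed.

Lemma ricci_bracket_abs_le N lo hi a b c :
  7 <= N -> 0 < lo -> lo <= a <= hi -> lo <= b <= hi -> lo <= c <= hi ->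
  Rabs (ricci_bracket N a b c) <= (N + 3) * hi + N + 5 + 2 * hi ^ 2 / lo ^ 3.
Proof.
  intros HN Hlo Ha Hb Hc. unfold ricci_bracket.
  assert (H1 : Rabs (2 * (a ^ 2 - (b - c) ^ 2) / (a * b * c)) <= 2 * hi ^ 2 / lo ^ 3).
  { apply div_prod3_abs_le; try lra. apply Rabs_le_between.
    assert (a ^ 2 <= hi ^ 2) by (apply pow_incr; lra).
    assert ((b - c) ^ 2 <= hi ^ 2) by nra.
    assert (0 <= a ^ 2) by apply pow2_ge_0. 
    assert (0 <= (b - c) ^ 2) by apply pow2_ge_0. lra. }
  apply Rabs_le_between in H1. apply Rabs_le_between.
  assert (H2 : 0 <= (N - 1) * a <= (N - 1) * hi).
  { split; [apply Rmult_le_pos | apply Rmult_le_compat_l]; lra. }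
  lra.
Qed.

Lemma exp_monotone u v : u <= v -> exp u <= exp v.
Proof.
  intros [H | ->]; [left; exact (exp_increasing u v H) | apply Rle_refl].
Qed.

(** The t_i stay within a bounded factor of their initial values by the bound
    on the displacement.  Since P is decreasing in y_1 and y_1 >= y_1(0), its
    bound at 0 also propagates up to the displacement of the other y_a. *)
Lemma uniform_t_P_bounds n sigma tau b :
  7 <= INR n -> 0 < sigma -> 0 < tau -> 0 < b < 1 ->
  exists lo hi Pm, 0 < lo /\
  forall phi y, BVP n phi y -> admissible_data n sigma tau phi ->
  forall x, 0 < x <= b ->
    (forall i, (1 <= i <= 3)%nat -> lo <= tfun y i x <= hi) /\ Pfun n y x <= Pm.
Proof.
  intros HN Hs Htau Hb.
  set (D := / (4 * (1 - b ^ 2)) + 8 * INR n).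
  set (h := (INR n + 5) / 3).
  exists (sigma * exp (- D)), (h * exp D),
    (INR n * (INR n - 1) / (2 * tau * sigma / h ^ 2) * exp (1 / INR n * (3 * D))).
  split; [apply Rmult_lt_0_compat; [lra | apply exp_pos]|].
  intros phi y HB HA x Hx.
  assert (HD : forall a, (2 <= a <= 4)%nat -> - D <= y a x - y a 0 <= D).
  { intros a Ha. apply Rabs_le_between.
    apply Rle_trans with (1 := displacement_le n sigma tau phi y a x HN Hs Htau HB HA Ha
      ltac:(lra)).
    apply Rplus_le_compat_r, Rinv_le_contravar; nra. }
  split.
  - intros i Hi.
    assert (H0 : sigma <= tfun y i 0 <= h).
    { rewrite (bvp_t0 _ _ _ HB i Hi).
      assert (H := adm_bounds _ _ _ _ HA i Hi). unfold h. lra. }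
    replace (tfun y i x) with (tfun y i 0 * exp (y (S i) x - y (S i) 0)).
    2:{ unfold tfun. rewrite <- exp_plus. f_equal. ring. }
    assert (HDi := HD (S i) ltac:(lia)).
    assert (E1 : exp (- D) <= exp (y (S i) x - y (S i) 0)) by (apply exp_monotone; lra).
    assert (E2 : exp (y (S i) x - y (S i) 0) <= exp D) by (apply exp_monotone; lra).
    assert (E3 := exp_pos (- D)).
    split; apply Rmult_le_compat; lra.
  - assert (H1 := y1_ge_initial n phi y x HN HB ltac:(lra)).
    assert (HP := Pfun_0_le n sigma tau phi y HN Hs Htau HB HA). fold h in HP.
    assert (HP0 := Pfun_pos n y 0).
    apply Rle_trans with (Pfun n y 0 * exp (1 / INR n * (3 * D))).
    2:{ apply Rmult_le_compat_r; [left; apply exp_pos | exact HP]. }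
    rewrite !Pfun_exp, <- exp_plus. apply exp_monotone.
    rewrite <- Rmult_plus_distr_l. apply Rmult_le_compat_l.
    { left. apply Rdiv_lt_0_compat; lra. }
    assert (H2 := HD 2%nat ltac:(lia)). assert (H3 := HD 3%nat ltac:(lia)).
    assert (H4 := HD 4%nat ltac:(lia)). lra.
Qed.

(** In the constraint the term that is singular at 0 has a favourable sign,
    because y_1' >= 0; every other term is bounded. *)
Lemma uniform_Psi_bound n sigma tau b :
  7 <= INR n -> 0 < sigma -> 0 < tau -> 0 < b < 1 ->
  exists B, forall phi y, BVP n phi y -> admissible_data n sigma tau phi ->
  forall x, 0 < x <= b -> Psi n y x / (2 * INR n ^ 2) <= B.
Proof.
  intros HN Hs Htau Hb.
  destruct (uniform_t_P_bounds n sigma tau b HN Hs Htau Hb) as (lo & hi & Pm & Hlo & Hbox).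
  set (q := 1 - b ^ 2). assert (Hq : 0 < q) by (unfold q; nra).
  set (s := 3 * INR n * hi + 18 * hi ^ 2 / lo ^ 3).
  set (B1 := 4 * INR n / q ^ 2).
  exists (B1 ^ 2 + 8 / q ^ 2 * (INR n * INR n + Pm * s)).
  intros phi y HB HA x Hx.
  destruct (Hbox phi y HB HA x Hx) as [Ht HP].
  assert (Ht1 := Ht 1%nat ltac:(lia)). assert (Ht2 := Ht 2%nat ltac:(lia)).
  assert (Ht3 := Ht 3%nat ltac:(lia)).
  assert (Hsc := sphere_scal_lower (INR n) lo hi _ _ _ HN Hlo Ht1 Ht2 Ht3). fold s in Hsc.
  assert (HP0 := Pfun_pos n y x).
  assert (Hs0 : 0 <= s).
  { unfold s. apply Rplus_le_le_0_compat; [nra|].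
    apply Rmult_le_pos; [nra | left; apply Rinv_0_lt_compat, pow_lt; lra]. }
  assert (HPS : - weighted_scal n y x <= Pm * s) by (unfold weighted_scal; nra).
  rewrite (Psi_constraint n phi y x HN HB) by lra.
  assert (Hqx : q <= 1 - x ^ 2) by (unfold q; nra).
  assert (Hq2 : q ^ 2 <= (1 - x ^ 2) ^ 2) by (apply pow_incr; lra).
  assert (Hq20 : 0 < q ^ 2) by (apply pow_lt; lra).
  assert (Hd := y1_deriv_bounds n sigma tau phi y x HN Hs Htau HB HA ltac:(lra)).
  set (d := deriv (y 1%nat) x) in *.
  assert (HdB : d <= B1).
  { apply Rle_trans with (1 := proj2 Hd). rewrite <- (Rmult_1_r B1).
    apply Rmult_le_compat; [ | lra | | lra].
    - left; apply Rdiv_lt_0_compat; lra.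
    - apply Rmult_le_compat_l; [lra | apply Rinv_le_contravar; lra]. }
  assert (T1 : (INR n - 1) / (2 * INR n) * d ^ 2 <= B1 ^ 2).
  { apply Rle_trans with (1 * d ^ 2).
    - apply Rmult_le_compat_r; [apply pow2_ge_0|]. apply Rle_div_l; lra.
    - rewrite Rmult_1_l. apply pow_incr. lra. }
  assert (T2 : 0 <= 2 * (INR n - 1) * (1 + x ^ 2) / (1 - x ^ 2) * (d / x)).
  { apply Rmult_le_pos.
    - left. apply Rdiv_lt_0_compat; nra.
    - apply Rmult_le_pos; [lra | left; apply Rinv_0_lt_compat; lra]. }
  assert (T3 : 8 / (1 - x ^ 2) ^ 2 * (INR n * (INR n - 1) - weighted_scal n y x)
     <= 8 / q ^ 2 * (INR n * INR n + Pm * s)).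
  { apply Rle_trans with (8 / (1 - x ^ 2) ^ 2 * (INR n * INR n + Pm * s)).
    - apply Rmult_le_compat_l; [left; apply Rdiv_lt_0_compat; lra | lra].
    - apply Rmult_le_compat_r; [nra|].
      apply Rmult_le_compat_l; [lra | apply Rinv_le_contravar; lra]. }
  lra.
Qed.

(** Splitting the coefficient of y_a' into (n-1)/x and a part that is regular
    at 0 isolates the only singular term. *)
Lemma log_t_equation n phi y a :
  BVP n phi y -> (2 <= a <= 4)%nat ->
  exists i j k, (1 <= i <= 3)%nat /\ (1 <= j <= 3)%nat /\ (1 <= k <= 3)%nat /\
  forall x, 0 < x < 1 ->
    deriv_n 2 (y a) x - (INR n - 1) / x * deriv (y a) x
    = 2 * INR n * x / (1 - x ^ 2) * deriv (y a) x
      - 1 / 2 * deriv (y 1%nat) x * deriv (y a) x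
      + 8 * Pfun n y x / (1 - x ^ 2) ^ 2
        * ricci_bracket (INR n) (tfun y i x) (tfun y j x) (tfun y k x).
Proof.
  intros HB Ha.
  assert (Hp : exists i j k, a = S i /\ is_123 i j k /\ (1 <= i <= 3)%nat
     /\ (1 <= j <= 3)%nat /\ (1 <= k <= 3)%nat).
  { assert (H : a = 2%nat \/ a = 3%nat \/ a = 4%nat) by lia.
    destruct H as [-> | [-> | ->]].
    - exists 1%nat, 2%nat, 3%nat. repeat split; try lia. apply Permutation_refl.
    - exists 2%nat, 1%nat, 3%nat. repeat split; try lia. apply perm_swap.
    - exists 3%nat, 1%nat, 2%nat. repeat split; try lia.
      apply (Permutation_cons_append [1; 2]%nat 3%nat). }
  destruct Hp as (i & j & k & -> & Hijk & Hi & Hj & Hk).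
  exists i, j, k. repeat (split; [assumption|]).
  intros x Hx. assert (He := bvp_t _ _ _ HB i j k Hijk x Hx).
  unfold eq_t in He. cbv zeta in He. unfold ricci_bracket.
  set (r := 8 * Pfun n y x / (1 - x ^ 2) ^ 2 * _) in *.
  set (d := deriv (y (S i)) x) in *.
  match type of He with ?u - ?v * d + _ - _ = 0 =>
    assert (E : v = (INR n - 1) / x + 2 * INR n * x / (1 - x ^ 2)) end.
  { field. nra. }
  rewrite E in He. lra.
Qed.

Lemma y1_linear_bound n sigma tau b :
  7 <= INR n -> 0 < sigma -> 0 < tau -> 0 < b < 1 ->
  forall phi y, BVP n phi y -> admissible_data n sigma tau phi ->
  forall x, 0 < x <= b ->
    Rabs (deriv (y 1%nat) x) <= 4 * INR n / (1 - b ^ 2) ^ 2 * x.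
Proof.
  intros HN Hs Htau Hb phi y HB HA x Hx.
  assert (Hd := y1_deriv_bounds n sigma tau phi y x HN Hs Htau HB HA ltac:(lra)).
  rewrite Rabs_pos_eq by lra.
  apply Rle_trans with (1 := proj2 Hd).
  assert (0 < 1 - b ^ 2) by nra.
  apply Rmult_le_compat_r; [lra|]. apply Rmult_le_compat_l; [lra|].
  apply Rinv_le_contravar; [apply pow_lt; lra | apply pow_incr; nra].
Qed.

Lemma y1_bounds n sigma tau b :
  7 <= INR n -> 0 < sigma -> 0 < tau -> 0 < b < 1 ->
  exists C, forall phi y, BVP n phi y -> admissible_data n sigma tau phi ->
  forall x, 0 < x <= b ->
    Rabs (deriv (y 1%nat) x) <= C * x /\ Rabs (deriv_n 2 (y 1%nat) x) <= C.
Proof.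
  intros HN Hs Htau Hb.
  destruct (uniform_Psi_bound n sigma tau b HN Hs Htau Hb) as [B HPsi].
  set (q := 1 - b ^ 2). assert (Hq : 0 < q <= 1) by (unfold q; nra).
  set (B1 := 4 * INR n / q ^ 2).
  assert (HB1 : 0 < B1) by (apply Rdiv_lt_0_compat; [lra | apply pow_lt; lra]).
  exists (Rmax B1 (4 / q * B1 + B1 ^ 2 + B)).
  intros phi y HB HA x Hx.
  assert (Hd := y1_linear_bound n sigma tau b HN Hs Htau Hb phi y HB HA x Hx).
  fold q B1 in Hd.
  split.
  { apply Rle_trans with (1 := Hd). apply Rmult_le_compat_r; [lra | apply Rmax_l]. }
  apply Rle_trans with (2 := Rmax_r _ _).
  specialize (HPsi phi y HB HA x Hx).
  assert (HPsi0 := Psi_nonneg n y x HN).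
  assert (He := bvp_K1 _ _ _ HB x ltac:(lra)). unfold eq_K1 in He.
  set (d := deriv (y 1%nat) x) in *.
  assert (HN2 : 0 < INR n ^ 2) by nra.
  assert (E : deriv_n 2 (y 1%nat) x
    = (1 + 3 * x ^ 2) / (1 - x ^ 2) * (d / x) - / (2 * INR n) * d ^ 2
      - Psi n y x / (2 * INR n ^ 2)).
  { apply Rminus_diag_uniq. rewrite <- He. field. repeat split; nra. }
  rewrite E.
  assert (Hqx : q <= 1 - x ^ 2) by (unfold q; nra).
  assert (T1 : Rabs ((1 + 3 * x ^ 2) / (1 - x ^ 2) * (d / x)) <= 4 / q * B1).
  { rewrite Rabs_mult. apply Rmult_le_compat; try apply Rabs_pos.
    - rewrite Rabs_pos_eq by (left; apply Rdiv_lt_0_compat; nra).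
      apply Rmult_le_compat; [nra | left; apply Rinv_0_lt_compat; lra | nra |].
      apply Rinv_le_contravar; lra.
    - rewrite Rabs_div by lra. rewrite (Rabs_pos_eq x) by lra.
      apply Rle_div_l; [lra | exact Hd]. }
  assert (T2 : 0 <= / (2 * INR n) * d ^ 2 <= B1 ^ 2).
  { assert (Hi : 0 < / (2 * INR n)) by (apply Rinv_0_lt_compat; lra).
    assert (Hi1 : / (2 * INR n) <= / 1) by (apply Rinv_le_contravar; lra).
    rewrite Rinv_1 in Hi1.
    assert (Hd2 : d ^ 2 <= B1 ^ 2).
    { rewrite <- (pow2_abs d). apply pow_incr. split; [apply Rabs_pos | nra]. }
    assert (Hd0 := pow2_ge_0 d). split; nra. }
  assert (T3 : 0 <= Psi n y x / (2 * INR n ^ 2)).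
  { apply Rmult_le_pos; [lra | left; apply Rinv_0_lt_compat; lra]. }
  apply Rabs_le_between in T1. apply Rabs_le_between. lra.
Qed.

Lemma abs_le_1_plus_sqr d Q : d ^ 2 <= Q -> Rabs d <= 1 + Q.
Proof. intros H. apply Rabs_le_between. nra. Qed.

(** The bound on Psi first gives a crude bound B on y_a', which makes the
    right-hand side of the equation for y_a bounded; the integrating factor
    improves this to linear decay, and the equation then bounds y_a''. *)
Lemma log_t_bounds n sigma tau b :
  (7 <= n)%nat -> 0 < sigma -> 0 < tau -> 0 < b < 1 ->
  exists C, forall phi y, BVP n phi y -> admissible_data n sigma tau phi ->
  forall a, (2 <= a <= 4)%nat -> forall x, 0 < x <= b ->
    Rabs (deriv (y a) x) <= C * x /\ Rabs (deriv_n 2 (y a) x) <= C.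
Proof.
  intros Hn Hs Htau Hb.
  assert (HN : 7 <= INR n) by (apply (le_INR 7) in Hn; simpl in Hn; lra).
  destruct (uniform_Psi_bound n sigma tau b HN Hs Htau Hb) as [B0 HPsi].
  destruct (uniform_t_P_bounds n sigma tau b HN Hs Htau Hb) as (lo & hi & Pm & Hlo & Hbox).
  set (q := 1 - b ^ 2). assert (Hq : 0 < q <= 1) by (unfold q; nra).
  assert (Hq2 : 0 < q ^ 2) by (apply pow_lt; lra).
  set (B1 := 4 * INR n / q ^ 2).
  assert (HB1 : 0 < B1) by (apply Rdiv_lt_0_compat; lra).
  set (B := 1 + 4 * B0).
  set (r := (INR n + 3) * hi + INR n + 5 + 2 * hi ^ 2 / lo ^ 3).
  set (M := 2 * INR n / q * B + 1 / 2 * B1 * B + 8 * Pm / q ^ 2 * r).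
  set (C1 := B / b + M).
  exists (Rmax C1 (INR n * C1 + M)).
  intros phi y HB HA a Ha.
  assert (HdB : forall x, 0 < x <= b -> Rabs (deriv (y a) x) <= B).
  { intros x Hx. apply abs_le_1_plus_sqr.
    assert (H1 := Psi_ge n y a x HN Ha). assert (H2 := HPsi phi y HB HA x Hx).
    apply Rle_div_l in H2; [|nra]. 
    apply Rmult_le_reg_r with (INR n ^ 2 / 2); nra. }
  destruct (log_t_equation n phi y a HB Ha) as (i & j & k & Hi & Hj & Hk & Heq).
  assert (HG : forall x, 0 < x <= b ->
    Rabs (deriv_n 2 (y a) x - (INR n - 1) / x * deriv (y a) x) <= M).
  { intros x Hx. rewrite Heq by lra.
    destruct (Hbox phi y HB HA x Hx) as [Ht HP].
    assert (Hr := ricci_bracket_abs_le (INR n) lo hi _ _ _ HN Hlo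
      (Ht i Hi) (Ht j Hj) (Ht k Hk)). fold r in Hr.
    specialize (HdB x Hx).
    assert (Hd1 := y1_linear_bound n sigma tau b HN Hs Htau Hb phi y HB HA x Hx).
    fold q B1 in Hd1.
    assert (Hqx : q <= 1 - x ^ 2) by (unfold q; nra).
    assert (Hqx2 : q ^ 2 <= (1 - x ^ 2) ^ 2) by (apply pow_incr; lra).
    assert (HP0 := Pfun_pos n y x).
    apply Rle_trans with (1 := Rabs_triang _ _).
    apply Rplus_le_compat.
    - apply Rle_trans with (1 := Rabs_triang _ _). rewrite Rabs_Ropp.
      apply Rplus_le_compat; rewrite Rabs_mult.
      + apply Rmult_le_compat; try apply Rabs_pos; [|exact HdB].
        rewrite Rabs_pos_eq by (left; apply Rdiv_lt_0_compat; nra).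
        apply Rmult_le_compat; [nra | left; apply Rinv_0_lt_compat; lra | nra |].
        apply Rinv_le_contravar; lra.
      + apply Rmult_le_compat; try apply Rabs_pos; [|exact HdB].
        rewrite Rabs_mult, (Rabs_pos_eq (1 / 2)) by lra. nra.
    - rewrite Rabs_mult. apply Rmult_le_compat; try apply Rabs_pos; [|exact Hr].
      rewrite Rabs_pos_eq by (left; apply Rdiv_lt_0_compat; lra).
      apply Rmult_le_compat; [lra | left; apply Rinv_0_lt_compat; lra | lra |].
      apply Rinv_le_contravar; lra. }
  assert (HC : forall x, 0 < x <= b -> Rabs (deriv (y a) x) <= C1 * x).
  { apply (linear_bound (deriv (y a)) (deriv_n 2 (y a)) (n - 2)); try lra; try lia.
    - intros x Hx. apply (smooth_is_derive (y a) 1); [|lra].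
      apply (bvp_smooth _ _ _ HB); lia.
    - intros x Hx. replace (S (n - 2)) with (n - 1)%nat by lia.
      rewrite minus_INR by lia. exact (HG x Hx).
    - apply HdB; lra. }
  intros x Hx. specialize (HC x Hx). split.
  { apply Rle_trans with (1 := HC). apply Rmult_le_compat_r; [lra | apply Rmax_l]. }
  apply Rle_trans with (2 := Rmax_r _ _).
  specialize (HG x Hx).
  assert (Hu : Rabs ((INR n - 1) / x * deriv (y a) x) <= INR n * C1).
  { replace ((INR n - 1) / x * deriv (y a) x) with ((INR n - 1) * (deriv (y a) x / x))
      by (field; lra).
    rewrite Rabs_mult. apply Rmult_le_compat; try apply Rabs_pos.
    - rewrite Rabs_pos_eq; lra.
    - rewrite Rabs_div by lra. rewrite (Rabs_pos_eq x) by lra.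
      apply Rle_div_l; [lra | exact HC]. }
  apply Rabs_le_between in Hu. apply Rabs_le_between in HG. apply Rabs_le_between.
  lra.
Qed.

(** The equations hold for x > 0 only; at x = 0 the bound on the second
    derivatives follows from their continuity. *)
Lemma estimate_up_to n sigma tau b :
  (7 <= n)%nat -> 0 < sigma -> 0 < tau -> 0 < b < 1 ->
  exists C, 0 < C /\ forall phi y, BVP n phi y -> admissible_data n sigma tau phi ->
    deriv_estimate y b C.
Proof.
  intros Hn Hs Htau Hb.
  assert (HN : 7 <= INR n) by (apply (le_INR 7) in Hn; simpl in Hn; lra).
  destruct (y1_bounds n sigma tau b HN Hs Htau Hb) as [C1 H1].
  destruct (log_t_bounds n sigma tau b Hn Hs Htau Hb) as [C2 H2].
  set (C := Rmax 1 (Rmax C1 C2)).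
  assert (HC0 : 1 <= C) by apply Rmax_l.
  assert (HC1 : C1 <= C) by (apply Rle_trans with (2 := Rmax_r _ _); apply Rmax_l).
  assert (HC2 : C2 <= C) by (apply Rle_trans with (2 := Rmax_r _ _); apply Rmax_r).
  exists C. split; [lra|].
  intros phi y HB HA.
  assert (H : forall i, (1 <= i <= 4)%nat -> forall x, 0 < x <= b ->
    Rabs (deriv (y i) x) <= C * x /\ Rabs (deriv_n 2 (y i) x) <= C).
  { intros i Hi x Hx. destruct (Nat.eq_dec i 1) as [-> | Hi1].
    - destruct (H1 phi y HB HA x Hx). split; [nra | lra].
    - destruct (H2 phi y HB HA i ltac:(lia) x Hx). split; [nra | lra]. }
  intros k i Hk Hi x Hx.
  assert (Hx0 : x = 0 \/ 0 < x) by lra.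
  assert (Hk' : k = 1%nat \/ k = 2%nat) by lia.
  destruct Hk' as [-> | ->]; simpl (_ - _)%nat.
  - rewrite pow_1. change (deriv_n 1 (y i) x) with (deriv (y i) x).
    destruct Hx0 as [-> | Hx0].
    + rewrite (bvp_deriv_0 _ _ _ HB i Hi), Rabs_R0. lra.
    + apply (H i Hi x); lra.
  - rewrite pow_O, Rmult_1_r.
    destruct Hx0 as [-> | Hx0]; [|apply (H i Hi x); lra].
    assert (Hlim := smooth_at_right_0 (y i) 2 (bvp_smooth _ _ _ HB i Hi)).
    assert (Hnear : at_right 0 (fun s => Rabs (deriv_n 2 (y i) s) <= C)).
    { apply (filter_imp (fun s => 0 < s <= b)); [|apply near_right_0; lra].
      intros s Hsb. apply (H i Hi s Hsb). }
    apply Rabs_le_between. split.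
    + apply (lim_ge (F := at_right 0) (deriv_n 2 (y i))); [|exact Hlim].
      revert Hnear. apply filter_imp. intros s Hsb. apply Rabs_le_between in Hsb. lra.
    + apply (lim_le (F := at_right 0) (deriv_n 2 (y i))); [|exact Hlim].
      revert Hnear. apply filter_imp. intros s Hsb. apply Rabs_le_between in Hsb. lra.
Qed.

Theorem lemma3p3 :
  forall (k n : nat), (1 <= k)%nat -> n = (4 * k + 3)%nat ->
  forall sigma tau : R, 0 < sigma < 1 -> 0 < tau ->
  (exists C : R, 0 < C /\
     forall (phi : nat -> R) (y : nat -> R -> R),
       BVP n phi y -> admissible_data n sigma tau phi ->
       deriv_estimate y (3 / 4) C)
  /\
  (forall eps : R, 0 < eps < 1 ->
   exists C : R, 0 < C /\
     forall (phi : nat -> R) (y : nat -> R -> R),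
       BVP n phi y -> admissible_data n sigma tau phi ->
       deriv_estimate y (1 - eps) C).
Proof.
  intros k n Hk -> sigma tau Hs Htau.
  split; [|intros eps Heps]; apply estimate_up_to; lia || lra.
Qed.
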